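(* Let $R$ be a resource measure for a quantum resource theory with free operations $\mathcal{O}$. Let $\rho_1,\dots,\rho_N$ ($N\ge 1$) be states, let $\Phi=\sum_i\Phi_i$ be a trace-preserving free operation decomposed into conditional free operations $\Phi_i$, acting on the joint system of $\rho_1\otimes\cdots\otimes\rho_N$ and with output in a single output system. Put $p_i=\mathrm{tr}[\Phi_i(\rho_1\otimes\cdots\otimes\rho_N)]$, $\sigma_i=\Phi_i(\rho_1\otimes\cdots\otimes\rho_N)/p_i$ for each $i$ with $p_i>0$, and $\sigma=\Phi(\rho_1\otimes\cdots\otimes\rho_N)=\sum_i p_i\sigma_i$. Then: (a) If $R$ satisfies (C2a) and (C4), then $R(\sigma)\le\max_j R(\rho_j)$. (b) If $R$ satisfies (C2b) and (C4), then $\sum_i p_iR(\sigma_i)\le\max_j R(\rho_j)$. (c) If $R$ satisfies (C2c) and (C4), then $R(\sigma_i)\le\max_j R(\rho_j)$ for every $i$ with $p_i>0$. Here (C2a), (C2b), (C2c), (C4) are the following properties of $R$: (C2a) $R(\rho)\ge R(\Phi(\rho))$ for every state $\rho$ and every trace-preserving free operation $\Phi$. (C2b) $R(\rho)\ge\sum_i p_iR(\sigma_i)$ for every state $\rho$ and every family of conditional free operations $\{\Phi_i\}$ whose sum is trace preserving, where $p_i=\mathrm{tr}[\Phi_i(\rho)]$, $\sigma_i=\Phi_i(\rho)/p_i$, and terms with $p_i=0$ are omitted. (C2c) $R(\rho)\ge R(\Phi_i(\rho)/p_i)$ for every state $\rho$ and every (possibly trace-non-preserving) free operation $\Phi_i$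 with $p_i=\mathrm{tr}[\Phi_i(\rho)]>0$. (C4) $R(\rho\otimes\sigma)=\max\{R(\rho),R(\sigma)\}$ for all states $\rho,\sigma$.
   Context: A quantum resource theory is given on a class of quantum systems (Hilbert spaces) closed under tensor products; the systems may have different dimensions. It specifies a set $\mathcal{O}$ of free operations, which are completely positive trace-non-increasing maps between systems in the class. Trace-preserving free operations are called deterministic. A family of free operations $\{\Phi_i\}$ (the ''conditional free operations'') whose sum $\Phi=\sum_i\Phi_i$ is a trace-preserving free operation represents a situation where the outcome $i$ is accessible individually. Free operations may change the system, for example by mapping an $N$-partite system to a single output system. A resource measure is a function $R$ assigning a real number $R(\rho)\ge 0$ to each state (density operator) $\rho$ of each system in the class. *)

(* Defs.v *)
From HB Require Import structures.
From mathcomp Require Import all_boot all_order all_algebra.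
From mathcomp Require Import sesquilinear complex.
From mathcomp Require Import all_classical all_reals all_analysis.
From mathcomp Require summability.

Set Implicit Arguments.
Unset Strict Implicit.
Unset Printing Implicit Defensive.
Import Order.TTheory GRing.Theory Num.Theory.
Import numFieldNormedType.Exports.

Local Open Scope classical_set_scope.
Local Open Scope ring_scope.
Local Open Scope complex_scope.

(* A complex Hilbert space of arbitrary dimension, finite or infinite. As in
   sesquilinear.v, the inner product is linear in its first argument and
   antilinear in its second. *)
Record hilbertSpace (R : realType) := HilbertSpace {
  hspace :> completeNormedModType R[i] ;
  hdot : {dot hspace for Num.conj} ;
  hdot_normE : forall x : hspace, hdot x x = `|x| ^+ 2
}.

Definition inner (R : realType) (H : hilbertSpace R) (x y : H) : R[i] :=
  hdot H x y.

(* The Hilbert space tensor product of H and K, characterized (uniquely up to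
   unitary isomorphism) as a Hilbert space HK with a map [t x y = x (x) y]. *)
Definition is_hilbert_tensor (R : realType) (H K HK : hilbertSpace R)
    (t : {bilinear H -> K -> HK}) : Prop :=
  (forall (x x' : H) (y y' : K),
     inner (t x y) (t x' y') = inner x x' * inner y y') /\
  dense [set z : HK | exists n (x : 'I_n -> H) (y : 'I_n -> K),
                        z = \sum_(i < n) t (x i) (y i)].

Section orthonormal_basis.
Variables (R : realType) (H : hilbertSpace R).

Definition orthonormal_set (B : set H) : Prop :=
  forall e f : H, B e -> B f -> inner e f = (e == f)%:R.

Definition orthonormal_basis (B : set H) : Prop :=
  orthonormal_set B /\
  (forall x : H, (forall e, B e -> inner x e = 0) -> x = 0).

Lemma innerC (x y : H) : inner x y = Num.conj (inner y x).
Proof.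
by rewrite {1}/inner (@hermitian_subproof _ _ _ _ (hdot H)) expr0 mul1r.
Qed.

Lemma exists_orthonormal_basis : exists B : set H, orthonormal_basis B.
Proof.
have chainP (F : set (set H)) : F `<=` orthonormal_set ->
    total_on F subset -> orthonormal_set (\bigcup_(X in F) X).
  move=> FP Ftot e f [X FX Xe] [Y FY Yf].
  have [XY|YX] := Ftot _ _ FX FY.
    by apply: (FP _ FY) => //; exact: XY.
  by apply: (FP _ FX) => //; exact: YX.
have [B [Bo Bmax]] := Zorn_bigcup chainP.
exists B; split => // x xB; apply/eqP; apply: contrapT => /negP x0.
have nx0 : `|x| != 0 by rewrite normr_eq0.
pose u : H := (`|x|^-1 : R[i]) *: x.
have uB e : B e -> inner u e = 0.
  by move=> Be; rewrite /inner /u linearZl_LR /= -/(inner x e) xB // mulr0.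
have Bu e : B e -> inner e u = 0.
  move=> Be.
  by rewrite innerC uB // rmorph0.
have uu : inner u u = 1.
  rewrite /inner hdot_normE /u normrZ normfV normr_id mulVf //.
  by rewrite expr1n.
have uNB : ~ B u.
  by move=> Bue; move: (uB _ Bue); rewrite uu => /eqP; rewrite oner_eq0.
apply: (Bmax (B `|` [set u])).
  split; first exact: subsetUl.
  by move=> /(_ u) h; apply/uNB/h; right.
move=> e f [Be|->] [Bf|->].
- exact: Bo.
- rewrite Bu //; case: eqP => // eu; by rewrite eu in Be.
- rewrite uB //; case: eqP => // eu; by rewrite -eu in Bf.
- by rewrite uu eqxx.
Qed.

Definition onb : set H := sval (cid exists_orthonormal_basis).

End orthonormal_basis.
Arguments onb {R} H.

Section operators.
Variables (R : realType) (H : hilbertSpace R).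

Definition bounded_op (T : H -> H) : Prop := linear T /\ continuous T.

Definition positive_op (T : H -> H) : Prop :=
  bounded_op T /\ (forall x : H, 0 <= inner (T x) x).

(* The trace, only meant for positive T: all the terms are then nonnegative,
   the sum is in [0, +oo] and does not depend on the orthonormal basis. *)
Definition trace (T : H -> H) : \bar R :=
  \esum_(e in onb H) (complex.Re (inner (T e) e))%:E.

(* T is trace class when |T| has finite trace; A is |T|, the positive square
   root of T^* T, the equation A^2 = T^* T being stated in weak form. *)
Definition trace_class (T : H -> H) : Prop :=
  bounded_op T /\
  exists A : H -> H,
    [/\ positive_op A,
        forall x y, inner (A x) (A y) = inner (T x) (T y)
      & (trace A < +oo)%E].

Record state := State {
  density :> H -> H ;
  state_positive : positive_op density ;
  state_trace : trace density = 1%E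
}.

End operators.

(* A linear map between the spaces of trace-class operators on H and on K is
   encoded by a function on all maps H -> H, whose values outside the
   trace-class operators are irrelevant. *)
Definition superop (R : realType) (H K : hilbertSpace R) : Type :=
  (H -> H) -> (K -> K).

Section superoperators.
Variables (R : realType) (H K : hilbertSpace R).
Implicit Types Phi : superop H K.

Definition linear_superop Phi : Prop :=
  (forall T, trace_class T -> trace_class (Phi T)) /\
  (forall (a : R[i]) (T S : H -> H), trace_class T -> trace_class S ->
     Phi (a *: T + S) = a *: Phi T + Phi S).

(* Positivity of the n x n block operator (T i j), acting on the direct sum of
   n copies of H. *)
Definition positive_block (L : hilbertSpace R) n (T : 'I_n -> 'I_n -> L -> L) :
    Prop :=
  forall x : 'I_n -> L, 0 <= \sum_(i < n) \sum_(j < n) inner (T i j (x j)) (x i).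

(* Positivity of id_n (x) Phi for every n. *)
Definition completely_positive Phi : Prop :=
  forall n (T : 'I_n -> 'I_n -> H -> H),
    (forall i j, trace_class (T i j)) ->
    positive_block T -> positive_block (fun i j => Phi (T i j)).

Definition trace_nonincreasing Phi : Prop :=
  forall T, positive_op T -> trace_class T -> (trace (Phi T) <= trace T)%E.

(* By linearity it is enough to consider positive T: these span the trace-class
   operators. *)
Definition trace_preserving Phi : Prop :=
  forall T, positive_op T -> trace_class T -> trace (Phi T) = trace T.

Definition quantum_operation Phi : Prop :=
  [/\ linear_superop Phi, completely_positive Phi & trace_nonincreasing Phi].

(* Phi is the sum of the Phi_ i: for each trace-class T, the finite partial
   sums of the operators Phi_ i T converge strongly to Phi T. If I is finite,
   this says that Phi T = \sum_i Phi_ i T. *)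
Definition is_sum_superop (I : countType) (Phi_ : I -> superop H K) Phi : Prop :=
  forall T, trace_class T -> forall y : K,
    summability.partial_sum (fun i => Phi_ i T y) @ summability.totally
      --> Phi T y.

(* The probability of Phi at rho and the corresponding normalized output. *)
Definition prob Phi (rho : state H) : R := fine (trace (Phi rho)).

Definition post Phi (rho : state H) : K -> K :=
  ((prob Phi rho)^-1)%:C *: Phi rho.

End superoperators.

(* Systems are labelled by an arbitrary type, so that distinct systems may
   have the same Hilbert space. *)
Record resource_theory (R : realType) := ResourceTheory {
  system : Type ;
  hilb : system -> hilbertSpace R ;
  tensor : system -> system -> system ;
  tensor_map : forall s t : system,
    {bilinear hilb s -> hilb t -> hilb (tensor s t)} ;
  tensor_mapP : forall s t : system, is_hilbert_tensor (tensor_map s t) ;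
  free_op : forall s t : system, superop (hilb s) (hilb t) -> Prop ;
  free_quantum_operation : forall (s t : system)
      (Phi : superop (hilb s) (hilb t)),
    free_op Phi -> quantum_operation Phi
}.

Section resource_theory.
Variables (R : realType) (Q : resource_theory R).

(* tau = rho (x) sigma; a bounded operator on the tensor product is determined
   by its values on the product vectors. *)
Definition is_tensor_state (s t : system Q) (rho : state (hilb s))
    (sigma : state (hilb t)) (tau : state (hilb (tensor s t))) : Prop :=
  forall (x : hilb s) (y : hilb t),
    tau (tensor_map s t x y) = tensor_map s t (rho x) (sigma y).

(* product_state [:: rho_1; ...; rho_N] tau: tau = rho_1 (x) ... (x) rho_N,
   the factors being taken in this order and bracketed in any way. *)
Inductive product_state :
    seq {s : system Q & state (hilb s)} ->
    forall s : system Q, state (hilb s) -> Prop :=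
| product_state1 (s : system Q) (rho : state (hilb s)) :
    product_state [:: existT (fun s => state (hilb s)) s rho] rho
| product_stateM l l' (s t : system Q) (rho : state (hilb s))
    (sigma : state (hilb t)) (tau : state (hilb (tensor s t))) :
    product_state l rho -> product_state l' sigma ->
    is_tensor_state rho sigma tau -> product_state (l ++ l') tau.

Definition conditional_free_operations (s t : system Q) (I : countType)
    (Phi_ : I -> superop (hilb s) (hilb t)) (Phi : superop (hilb s) (hilb t)) :
    Prop :=
  [/\ forall i, free_op (Phi_ i), free_op Phi, trace_preserving Phi
    & is_sum_superop Phi_ Phi].

(* The values of a measure on operators that are not states are irrelevant. *)
Record resource_measure := ResourceMeasure {
  measure_of :> forall s : system Q, (hilb s -> hilb s) -> R ;
  resource_measure_ge0 : forall (s : system Q) (rho : state (hilb s)), 0 <= measure_of rho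
}.

Definition C2a (M : resource_measure) : Prop :=
  forall (s t : system Q) (rho : state (hilb s))
    (Phi : superop (hilb s) (hilb t)),
    free_op Phi -> trace_preserving Phi -> M t (Phi rho) <= M s rho.

Definition C2b (M : resource_measure) : Prop :=
  forall (s t : system Q) (rho : state (hilb s)) (I : countType)
    (Phi_ : I -> superop (hilb s) (hilb t)) (Phi : superop (hilb s) (hilb t)),
    conditional_free_operations Phi_ Phi ->
    (\esum_(i in [set i | (0 < prob (Phi_ i) rho)%R])
       (prob (Phi_ i) rho * M t (post (Phi_ i) rho))%:E <= (M s rho)%:E)%E.

Definition C2c (M : resource_measure) : Prop :=
  forall (s t : system Q) (rho : state (hilb s))
    (Phi : superop (hilb s) (hilb t)),
    free_op Phi -> 0 < prob Phi rho -> M t (post Phi rho) <= M s rho.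

Definition C4 (M : resource_measure) : Prop :=
  forall (s t : system Q) (rho : state (hilb s)) (sigma : state (hilb t))
    (tau : state (hilb (tensor s t))),
    is_tensor_state rho sigma tau ->
    M (tensor s t) tau = Num.max (M s rho) (M t sigma).

End resource_theory.

(* Main.v *)
Require Import Defs.
From HB Require Import structures.
From mathcomp Require Import all_boot all_order all_algebra.
From mathcomp Require Import sesquilinear complex.
From mathcomp Require Import all_classical all_reals all_analysis.

Set Implicit Arguments.
Unset Strict Implicit.
Unset Printing Implicit Defensive.
Import Order.TTheory GRing.Theory Num.Theory.
Import numFieldNormedType.Exports.

Local Open Scope classical_set_scope.
Local Open Scope ring_scope.

(** Tensoring does not raise the measure above its largest factor: (C4), applied repeatedly, bounds
    the measure of [tau] by the maximum over the [rho j]. This is [product_state_le_bigmax]. Each of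
    (C2a), (C2b), (C2c) bounds its output quantity by the measure of the joint input, so each part
    follows by transitivity. As measures are nonnegative on states and [N] is positive, the default
    [0] of the big maximum leaves its value unchanged. *)

(** Induction on the derivation of [product_state] handles every bracketing at once: (C4) splits the
    top tensor product, and each half is bounded by the maximum over its own sublist. *)
Lemma product_state_le_bigmax (R : realType) (Q : resource_theory R)
    (M : resource_measure Q) (l : seq {s : system Q & state (hilb s)})
    (s : system Q) (tau : state (hilb s)) :
  C4 M -> product_state l tau ->
  M s tau <= \big[Num.max/0]_(x <- l) M (projT1 x) (projT2 x).
Proof.
move=> c4; elim=> {l s tau}
  [s rho|l l' s t rho sigma tau _ IHl _ IHl' /c4 ->].
  by rewrite big_seq1_id le_max lexx.
(* [sub_bigmax_seq] compares lists by membership, which needs decidable equality; the dependent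
   pairs are therefore replaced by their real values under [f]. *)
pose f (x : {s : system Q & state (hilb s)}) := M (projT1 x) (projT2 x).
rewrite -!(big_map f xpredT id) in IHl IHl' *; rewrite map_cat.
rewrite ge_max; apply/andP; split.
  by apply: le_trans IHl _; apply: sub_bigmax_seq => x; rewrite mem_cat => ->.
apply: le_trans IHl' _; apply: sub_bigmax_seq => x.
by rewrite mem_cat orbC => ->.
Qed.

Theorem mainTheorem1 (R : realType) (Q : resource_theory R)
    (M : resource_measure Q)
    (N : nat) (hN : (1 <= N)%N)
    (sys : 'I_N -> system Q) (rho : forall j : 'I_N, state (hilb (sys j)))
    (joint : system Q) (tau : state (hilb joint))
    (htau : product_state
              [seq existT (fun s => state (hilb s)) (sys j) (rho j)
                 | j <- enum 'I_N] tau)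
    (out : system Q) (I : countType)
    (Phi_ : I -> superop (hilb joint) (hilb out))
    (Phi : superop (hilb joint) (hilb out))
    (hPhi : conditional_free_operations Phi_ Phi) :
  let p i := prob (Phi_ i) tau in
  let sigma_ i := post (Phi_ i) tau in
  let sigma := Phi tau in
  let maxR := \big[Num.max/0]_(j < N) M (sys j) (rho j) in
  [/\ C2a M -> C4 M -> M out sigma <= maxR,
      C2b M -> C4 M ->
        (\esum_(i in [set i | (0 < p i)%R])
           (p i * M out (sigma_ i))%:E <= maxR%:E)%E
    & C2c M -> C4 M -> forall i, 0 < p i -> M out (sigma_ i) <= maxR].
Proof.
have [free_Phi_ free_Phi tp_Phi _] := hPhi.
move=> p sigma_ sigma maxR.
have le_tau : C4 M -> M joint tau <= maxR.
  (* The maximum over the list of pairs is reindexed by ['I_N], which gives [maxR]. *)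
  by move=> c4; have := product_state_le_bigmax c4 htau; rewrite big_map big_enum.
split=> [c2a|c2b|c2c] /le_tau le_maxR.
- exact: le_trans (c2a _ _ _ _ free_Phi tp_Phi) le_maxR.
- by apply: le_trans (c2b _ _ _ _ _ _ hPhi) _; rewrite lee_fin.
- by move=> i p_gt0; exact: le_trans (c2c _ _ _ _ (free_Phi_ i) p_gt0) le_maxR.
Qed.
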